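(* Let $G$ be a graph with all edge weights equal to $1$ and let $x$ be an eigenvector of the graph Laplacian $L(G)$ for the eigenvalue $\lambda$. Assume that the vertices carrying nonzero components of $x$ can be partitioned into pairs $\{i,j\}$ such that $x_i=-x_j\neq 0$ for each pair. Let $G'$ be the graph obtained from $G$ by including $k$ soft nodes between each pair $\{i,j\}$, and let $x'$ be the extension of $x$ by the value $0$ on all the new vertices. Then $x'$ is an eigenvector of $L(G')$ for the eigenvalue $\lambda+k$.
   Context: A graph has a finite vertex set and is connected, with no loops and no multiple edges. The graph Laplacian of a graph with $n$ vertices is the $n\times n$ matrix $L$ with $L_{ij}=-1$ if $i\neq j$ and the edge $ij$ exists, $L_{ij}=0$ if $i\neq j$ and it does not, and $L_{ii}$ equal to the degree of $i$. A soft node for an eigenvector is a vertex where the eigenvector has component $0$. ''Including $k$ soft nodes between the pair $\{i,j\}$'' means adding $k$ new vertices (distinct new vertices for distinct pairs), each connected by one edge to $i$ and one edge to $j$ and to no other vertex; all vertices and edges of $G$ are kept. *)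

(* Defs.v *)
From HB Require Import structures.
From mathcomp Require Import all_boot all_order all_algebra.

Set Implicit Arguments.
Unset Strict Implicit.
Unset Printing Implicit Defensive.

Import Order.TTheory GRing.Theory Num.Theory.
Local Open Scope ring_scope.

Record graph := Graph {
  vertex : finType;
  adj : rel vertex;
  adj_sym : symmetric adj;
  adj_irr : irreflexive adj;
  adj_conn : forall u v, connect adj u v }.

Definition degree (G : graph) (v : vertex G) : nat := #|[set u | adj v u]|.

(* Rows and columns are numbered by [enum_val : 'I_#|vertex G| -> vertex G],
   whose inverse is [enum_rank]. *)
Definition laplacian (R : pzRingType) (G : graph) : 'M[R]_#|vertex G| :=
  \matrix_(i, j)
    if i == j then (degree (enum_val i))%:R
    else if adj (enum_val i) (enum_val j) then -1 else 0.

Definition component (R : Type) (G : graph) (x : 'cV[R]_#|vertex G|)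
  (v : vertex G) : R := x (enum_rank v) 0.

Definition is_eigenvector (R : pzRingType) (n : nat) (A : 'M[R]_n) (a : R)
  (x : 'cV[R]_n) : Prop := x != 0 /\ A *m x = a *: x.

Section SoftNodes.

Variables (G : graph) (P : {set {set vertex G}}) (k : nat).

(* [inr (A, t)] is the [t]-th new vertex attached to the pair [A]. *)
Definition soft_vertex : finType :=
  (vertex G + {A : {set vertex G} | A \in P} * 'I_k)%type.

Definition soft_adj : rel soft_vertex := fun a b =>
  match a, b with
  | inl u, inl v => adj u v
  | inl u, inr (A, _) => u \in val A
  | inr (A, _), inl v => v \in val A
  | inr _, inr _ => false
  end.

Lemma soft_adj_sym : symmetric soft_adj.
Proof. by move=> [u|[A s]] [v|[B t]] //=; rewrite adj_sym. Qed.

Lemma soft_adj_irr : irreflexive soft_adj.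
Proof. by move=> [u|[A s]] //=; rewrite adj_irr. Qed.

Hypothesis P2 : {in P, forall A : {set vertex G}, #|A| = 2%N}.

Lemma soft_adj_conn (a b : soft_vertex) : connect soft_adj a b.
Proof.
have csym := sym_connect_sym soft_adj_sym.
have old u v : connect soft_adj (inl u) (inl v).
  have /connectP[p pth ->] := adj_conn u v.
  elim: p u pth => [|w p IH] u //= /andP[uw pth].
  exact: connect_trans (connect1 (uw : soft_adj (inl u) (inl w))) (IH w pth).
have near c : exists u, connect soft_adj c (inl u).
  case: c => [u|[A t]]; first by exists u.
  have /card_gt0P[u uA] : (0 < #|val A|)%N by rewrite P2 ?(valP A).
  by exists u; apply: connect1.
have [[u au] [v bv]] := (near a, near b).
by apply: connect_trans au (connect_trans (old u v) _); rewrite csym.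
Qed.

Definition add_soft_nodes : graph :=
  Graph soft_adj_sym soft_adj_irr soft_adj_conn.

Definition extend_by_zero (R : pzRingType) (x : 'cV[R]_#|vertex G|) :
  'cV[R]_#|vertex add_soft_nodes| :=
  \col_i match (enum_val i : soft_vertex) with
         | inl v => component x v
         | inr _ => 0
         end.

End SoftNodes.

Arguments add_soft_nodes [G P] k P2.
Arguments extend_by_zero [G P] k P2 [R] x.

(* Main.v *)
Require Import Defs.
From mathcomp Require Import all_boot all_order all_algebra.

Set Implicit Arguments.
Unset Strict Implicit.
Unset Printing Implicit Defensive.

Import Order.TTheory GRing.Theory Num.Theory.
Local Open Scope ring_scope.

(** The Laplacian acts on a vector, read as a function on the vertices, as
    [(L x)(v) = \sum_(u ~ v) (x v - x u)].  An old vertex [v] with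
    [x v != 0] lies in exactly one pair of the partition, so it gains [k] new
    neighbours, all of value [0]; each contributes [x v], and [(L x)(v)] grows
    by [k * x v].  An old vertex with [x v = 0] lies in no pair, so its sum
    is unchanged.  At a new vertex the value of [L' x'] is minus the sum of [x] over
    the two members of its pair, which cancel, as required by [x' = 0] there.
    The three facts are [laplacian_component], [sum_soft_neighbours] and
    [sum_opposite_pair]. *)

Lemma component_eqP (T : Type) (G : graph) (x y : 'cV[T]_#|vertex G|) :
  x = y <-> component x =1 component y.
Proof.
split=> [-> //|xy]; apply/matrixP=> i j.
by rewrite (ord1 j) -(enum_valK i); apply: xy.
Qed.

(** The sum over column indices becomes a sum over neighbours, in which the
    degree on the diagonal supplies one copy of [x v] for each neighbour. *)
Lemma laplacian_component (R : pzRingType) (G : graph)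
    (x : 'cV[R]_#|vertex G|) (v : vertex G) :
  component (laplacian R G *m x) v
    = \sum_(u | adj v u) (component x v - component x u).
Proof.
rewrite /component mxE (reindex enum_rank) /=; last first.
  by exists enum_val => ? _; rewrite ?enum_rankK ?enum_valK.
rewrite (bigD1 v) //= mxE eqxx enum_rankK sumrB sumr_const mulr_natl.
congr (_ *+ _ + _); first by rewrite /degree cardsE.
rewrite -sumrN [RHS]big_mkcond [RHS](bigD1 v) //= adj_irr add0r.
apply: eq_bigr => u uv; rewrite mxE (inj_eq enum_rank_inj) eq_sym (negPf uv).
by rewrite !enum_rankK; case: ifP => _; rewrite ?mulN1r ?mul0r.
Qed.

Lemma laplacian_eqP (R : pzRingType) (G : graph) (a : R)
    (x : 'cV[R]_#|vertex G|) :
  laplacian R G *m x = a *: x <->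
  forall v, \sum_(u | adj v u) (component x v - component x u)
              = a * component x v.
Proof.
have scaleE v : component (a *: x) v = a * component x v.
  by rewrite /component mxE.
split=> [/component_eqP Lx v|Lx].
  by rewrite -laplacian_component Lx scaleE.
by apply/component_eqP=> v; rewrite laplacian_component Lx scaleE.
Qed.

Lemma sum_opposite_pair (V : zmodType) (T : finType) (f : T -> V)
    (A : {set T}) :
  #|A| = 2%N -> {in A &, forall i j, i != j -> f i = - f j} ->
  \sum_(i in A) f i = 0.
Proof.
case/eqP/cards2P=> i [j [ij ->]] fN.
by rewrite big_setU1 ?inE //= big_set1 (fN i j) ?inE ?eqxx ?orbT // addNr.
Qed.

(** A vertex of [D] lies in its block [pblock P v] and in no other block, so
    it has exactly [k] new neighbours; any other vertex has none. *)
Lemma sum_soft_neighbours (V : nmodType) (T : finType) (P : {set {set T}})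
    (D : {set T}) (k : nat) (v : T) (c : V) :
  partition P D -> (v \notin D -> c = 0) ->
  \sum_(p : {A : {set T} | A \in P} * 'I_k | v \in val p.1) c = c *+ k.
Proof.
case/and3P=> /eqP covP tiP _ c0.
have [vD|/c0->] := boolP (v \in D); last by rewrite mul0rn big1.
have vP : v \in cover P by rewrite covP.
pose B : {A : {set T} | A \in P} := Sub (pblock P v) (pblock_mem vP).
(* The trivial condition makes the range a product, as [pair_big] expects. *)
have inB (p : {A : {set T} | A \in P} * 'I_k) :
    (v \in val p.1) = (p.1 == B) && true.
  move: p => [A t] /=; rewrite andbT -val_eqE /=.
  apply/idP/eqP => [vA|->]; last by rewrite mem_pblock.
  by rewrite (def_pblock tiP (valP A) vA).
rewrite (eq_bigl _ _ inB).
rewrite -(pair_big (fun A => A == B) (fun _ : 'I_k => true) (fun _ _ => c)) /=.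
by rewrite big_pred1_eq sumr_const card_ord.
Qed.

Section ExtendByZero.

Variables (R : pzRingType) (G : graph) (P : {set {set vertex G}}) (k : nat).
Variables (P2 : {in P, forall A : {set vertex G}, #|A| = 2%N}).
Variable (x : 'cV[R]_#|vertex G|).

Lemma component_extend_old (v : vertex G) :
  component (extend_by_zero k P2 x) (inl v : vertex (add_soft_nodes k P2))
    = component x v.
Proof. by rewrite {1}/component mxE enum_rankK. Qed.

Lemma component_extend_new (p : {A : {set vertex G} | A \in P} * 'I_k) :
  component (extend_by_zero k P2 x) (inr p : vertex (add_soft_nodes k P2)) = 0.
Proof. by rewrite {1}/component mxE enum_rankK. Qed.

Lemma extend_by_zero_eq0 : extend_by_zero k P2 x = 0 -> x = 0.
Proof.
move/component_eqP=> x0; apply/component_eqP=> v.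
by rewrite -component_extend_old x0 /component !mxE.
Qed.

End ExtendByZero.

Theorem theorem5p1 (R : realFieldType) (G : graph) (lambda : R)
  (x : 'cV[R]_#|vertex G|)
  (hx : is_eigenvector (laplacian R G) lambda x)
  (P : {set {set vertex G}})
  (P2 : {in P, forall A : {set vertex G}, #|A| = 2%N})
  (Ppart : partition P [set v | component x v != 0])
  (Popp : forall (A : {set vertex G}) (i j : vertex G),
     A \in P -> i \in A -> j \in A -> i != j ->
     component x i = - component x j /\ component x i <> 0)
  (k : nat) :
  is_eigenvector (laplacian R (add_soft_nodes k P2)) (lambda + k%:R)
    (extend_by_zero k P2 x).
Proof.
case: hx => x0 /laplacian_eqP Lx.
split; first by apply: contra_neq x0; apply: extend_by_zero_eq0.
apply/laplacian_eqP=> -[v|[A t]]; rewrite big_sumType /=.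
- rewrite component_extend_old mulrDl -Lx mulr_natl.
  congr (_ + _); first by apply: eq_bigr => u _; rewrite component_extend_old.
  rewrite -(sum_soft_neighbours k Ppart (v := v)); last first.
    by rewrite inE negbK => /eqP.
  by apply: eq_big => [[A t]|p _] //; rewrite component_extend_new subr0.
- rewrite component_extend_new mulr0 big_pred0_eq addr0.
  rewrite (eq_bigr (fun u => - component x u)); last first.
    by move=> u _; rewrite component_extend_old sub0r.
  rewrite sumrN sum_opposite_pair ?oppr0 //; first exact: P2 (valP A).
  by move=> i j iA jA ij; case: (Popp _ _ _ (valP A) iA jA ij).
Qed.
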